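(* Let $\rho$ be a positive integer, let $q'$ be a prime power, $q=(q')^{\rho+1}$, and let $v>\rho+1$. Then $PG(v,q)$ contains a $\rho$-saturating set of size $$\frac{V_{q'}(v+1,v-\rho+1)-1}{q'-1},$$ a quantity asymptotic to $\binom{v+1}{\rho}q^{\frac{v-\rho}{\rho+1}}$ as $q\to\infty$.
   Context: $V_{q'}(n,R)=\sum_{i=0}^{R}(q'-1)^i\binom{n}{i}$. A point set $S\subseteq PG(v,q)$ is $\varrho$-saturating if for every point $x\in PG(v,q)$ there exist $\varrho+1$ points of $S$ generating a subspace of $PG(v,q)$ containing $x$, and $\varrho$ is the smallest value with this property. *)

(* Defs.v *)
From HB Require Import structures.
From mathcomp Require Import all_boot all_order all_algebra.
From mathcomp Require Import all_classical all_reals all_analysis.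

Set Implicit Arguments.
Unset Strict Implicit.
Unset Printing Implicit Defensive.

Import Order.TTheory GRing.Theory Num.Theory.
Import numFieldNormedType.Exports.

Local Open Scope ring_scope.

Definition prime_power (m : nat) : Prop :=
  exists p k : nat, [/\ prime p, (0 < k)%N & m = (p ^ k)%N].

(* Number of vectors in a Hamming ball of radius r in the n-space over a field
   with b elements. *)
Definition hamming_ball_size (b n r : nat) : nat :=
  (\sum_(i < r.+1) (b - 1) ^ i * 'C(n, i))%N.

(* PG(v, F): the points are the one-dimensional subspaces of F^(v+1). *)
Record pg_point (F : fieldType) (v : nat) := PGPoint {
  pg_space :> {vspace 'rV[F]_v.+1};
  pg_pointP : \dim pg_space == 1%N }.

HB.instance Definition _ (F : fieldType) (v : nat) :=
  [isSub for @pg_space F v].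
HB.instance Definition _ (F : fieldType) (v : nat) :=
  [Choice of pg_point F v by <:].

(* Finiteness comes from the canonical generator matrix of a subspace. *)
Definition pg_mx (F : fieldType) (v : nat) (x : pg_point F v) :=
  VectorInternalTheory.vs2mx (pg_space x).

Definition pg_unmx (F : fieldType) (v : nat) (A : 'M[F]_(dim 'rV[F]_v.+1)) :
    option (pg_point F v) :=
  insub (VectorInternalTheory.mx2vs A).

Lemma pg_mxK (F : fieldType) (v : nat) : pcancel (@pg_mx F v) (@pg_unmx F v).
Proof.
by move=> x; rewrite /pg_mx /pg_unmx VectorInternalTheory.vs2mxK valK.
Qed.

HB.instance Definition _ (F : finFieldType) (v : nat) :=
  isCountable.Build (pg_point F v) (pcan_pickleK (@pg_mxK F v)).
HB.instance Definition _ (F : finFieldType) (v : nat) :=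
  fintype.isFinite.Build (pg_point F v) (pcan_enumP (@pg_mxK F v)).

(* The subspace generated by T is the join (vector space sum) of its points,
   and incidence is inclusion. The k+1 points are pairwise distinct, as T is a
   set. *)
Definition pg_covered (F : finFieldType) (v k : nat) (S : {set pg_point F v}) :
    Prop :=
  forall x : pg_point F v, exists T : {set pg_point F v},
    [/\ T \subset S, #|T| = k.+1 &
        (pg_space x <= \sum_(y in T) pg_space y)%VS].

Definition saturating (F : finFieldType) (v rho : nat)
    (S : {set pg_point F v}) : Prop :=
  pg_covered rho S /\ (forall k : nat, pg_covered k S -> (rho <= k)%N).

Definition saturating_size (R : realType) (rho v b : nat) : R :=
  ((hamming_ball_size b (v + 1) (v - rho + 1))%:R - 1) / (b%:R - 1).

(* Main.v *)
(* Let K be the subfield of order q' of F, so that F has dimension rho+1 over K,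
   and put n = v+1.  The saturating set consists of the K-rational points of
   weight at most n-rho.  Expanding the coordinates of a vector of F^n in a
   K-basis of F puts the vector in the F-span of a (rho+1)-dimensional
   subspace of K^n, and such a subspace has a reduced echelon basis, whose
   vectors have at least rho zeros each.  Conversely, the coordinates of a
   vector in the span of k+1 K-rational points lie in a K-subspace of F of
   dimension at most k+1, so that a point whose coordinates span F over K
   needs rho+1 of them.  The size divided by q'^(v-rho) is a polynomial in 1/q'
   with constant term 'C(v+1, rho), whence the asymptotics. *)
Require Import Defs.
From mathcomp Require Import all_boot all_order all_algebra.
From mathcomp Require Import all_fingroup cyclic all_field.
From mathcomp Require Import all_classical all_reals all_analysis.
From mathcomp Require Import zify.

Set Implicit Arguments.
Unset Strict Implicit.
Unset Printing Implicit Defensive.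

Import Order.TTheory GRing.Theory Num.Theory.
Import numFieldNormedType.Exports.

Local Open Scope ring_scope.

(** * Subfields of a finite field and bases over them *)

(** The Galois group over the base field is cyclic of order [d * e]. If [al] generates it, then
    [al ^+ d] has order [e], so its fixed field has codimension [e], hence dimension [d]. *)
Lemma exists_subfield_of_dim (F0 : finFieldType) (L : splittingFieldType F0)
    (d e : nat) :
  (0 < d)%N -> \dim {:L} = (d * e)%N ->
  exists K : {subfield L}, \dim K = d /\ \dim_K {:L} = e.
Proof.
move=> d_gt0 dimL.
have [al /eqP gen_al _] := finField_galois_generator (sub1v {:L}%AS).
have o_al : #[al]%g = (d * e)%N.
  rewrite orderE -gen_al -(galois_dim (finField_galois (sub1v {:L}%AS))).
  by rewrite dimv1 divn1.
have e_gt0 : (0 < e)%N.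
  case: e dimL o_al => // _; rewrite muln0 => /eqP.
  by rewrite -leqn0 leqNgt order_gt0.
exists (fixedField <[al ^+ d]>%g)%AS.
have H : \dim_(fixedField <[al ^+ d]>%g) {:L} = e.
  by rewrite -dim_fixedField -orderE orderXdiv o_al ?dvdn_mulr // mulKn.
split=> //.
have /field_dimS := fixedField_bound <[al ^+ d]>%g.
rewrite dvdn_eq H dimL => /eqP Hd.
by apply/eqP; rewrite -(eqn_pmul2l e_gt0) Hd mulnC.
Qed.

Lemma finField_basis_over_subfield (q' m : nat) (F : finFieldType) :
  prime_power q' -> #|F| = (q' ^ m)%N ->
  exists (K : finFieldType) (iota : {rmorphism K -> F}) (b : 'I_m -> F),
  [/\ #|K| = q',
      forall x, exists c : 'I_m -> K, x = \sum_i iota (c i) * b i &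
      forall c : 'I_m -> K, \sum_i iota (c i) * b i = 0 -> forall i, c i = 0].
Proof.
move=> [p [k [p_pr k_gt0 ->]]] oF; rewrite -expnM in oF.
have charFp := card_finPcharP oF p_pr.
pose L : splittingFieldType 'F_p := pPrimeCharType charFp.
have dimL : \dim {:L} = (k * m)%N.
  by rewrite (pprimeChar_dimf charFp) oF pfactorK.
have [K [dimK codimK]] := exists_subfield_of_dim k_gt0 dimL.
pose KT : finFieldType := FinFieldExtType (subvs_of K).
have fullE : vspaceOver K {:L} = {: fieldOver K}%VS.
  apply/vspaceP=> x; rewrite [RHS]memvf (mem_aspaceOver (subvf K)); exact: memvf.
have dimKL : \dim {: fieldOver K} = m.
  by rewrite -codimK -(dim_aspaceOver (subvf K)) fullE.
pose io : {rmorphism KT -> F} := (vsval : {rmorphism subvs_of K -> L}).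
pose B := vbasis {: fieldOver K}.
have freeB : free B := basis_free (vbasisP _).
(* Replacing [m] by the dimension lets the tuple [B] be indexed by ['I_m] without a cast. *)
case: m / dimKL {oF dimL codimK}.
exists KT, io, (fun i => B`_i); split.
- rewrite -(card_vspacef (Vector.class (finvect_type (subvs_of K)))) card_vspace.
  by rewrite card_Fp // dimvf -dimK.
- move=> x; exists (fun i => coord B i (x : fieldOver K)).
  exact: coord_vbasis (memvf (x : fieldOver K)).
- by move=> c; exact: (freeP freeB c).
Qed.

(** * Supports of vectors and the size of a Hamming ball *)

Definition row_supp (K : fieldType) (n : nat) (u : 'rV[K]_n) : {set 'I_n} :=
  [set j | u 0 j != 0].

Lemma row_supp_eq0 (K : fieldType) (n : nat) (u : 'rV[K]_n) :
  (row_supp u == finset.set0) = (u == 0).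
Proof.
apply/eqP/eqP=> [u0 | ->]; last by apply/setP=> j; rewrite !inE mxE eqxx.
by apply/rowP=> j; move/setP/(_ j): u0; rewrite !inE mxE => /negbFE/eqP.
Qed.

Lemma row_suppZ (K : fieldType) (n : nat) (c : K) (u : 'rV[K]_n) :
  c != 0 -> row_supp (c *: u) = row_supp u.
Proof. by move=> c0; apply/setP=> j; rewrite !inE mxE mulf_eq0 negb_or c0. Qed.

(** Coordinates are chosen independently: [#|K| - 1] nonzero values on [A], and only the value 0
    elsewhere. *)
Lemma card_row_supp (K : finFieldType) (n : nat) (A : {set 'I_n}) :
  #|[set u : 'rV[K]_n | row_supp u == A]| = ((#|K| - 1) ^ #|A|)%N.
Proof.
pose D (j : 'I_n) := [pred x : K | (x != 0) == (j \in A)].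
pose tofun (u : 'rV[K]_n) := [ffun j => u 0 j].
have tofunI : injective tofun.
  by move=> u w /ffunP H; apply/rowP=> j; have := H j; rewrite !ffunE.
transitivity #|family D|.
  rewrite -(card_imset _ tofunI); apply: eq_card => f; apply/imsetP/familyP.
    case=> u; rewrite inE => /eqP uA -> j.
    by rewrite !inE ffunE -uA inE eqxx.
  move=> fD; exists (\row_j f j).
    by rewrite inE; apply/eqP/setP=> j; rewrite !inE mxE (eqP (fD j)).
  by apply/ffunP=> j; rewrite ffunE mxE.
rewrite card_family foldrE big_map big_enum /= (bigID (mem A)) /=.
rewrite [X in (_ * X)%N]big1 ?muln1 => [|j /negbTE jA]; last first.
  rewrite -[RHS](card1 (0 : K)); apply: eq_card => x.
  by rewrite !inE jA unfold_in eqbF_neg negbK.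
under eq_bigr => j jA.
  rewrite (_ : #|_| = (#|K| - 1)%N); first over.
  rewrite subn1 -(cardC1 (0 : K)); apply: eq_card => x.
  by rewrite !inE jA unfold_in eqb_id.
by rewrite prod_nat_const.
Qed.

Lemma card_hamming_ball (K : finFieldType) (n r : nat) :
  #|[set u : 'rV[K]_n | (#|row_supp u| <= r)%N]| = hamming_ball_size #|K| n r.
Proof.
rewrite /hamming_ball_size -sum1_card.
under eq_bigl => u do rewrite inE.
(* Vectors are sorted by weight, then, for each weight, by support. *)
rewrite (partition_big (fun u => inord #|row_supp u| : 'I_r.+1) predT) //=.
apply: eq_bigr => i _.
transitivity (\sum_(u : 'rV[K]_n | #|row_supp u| == i) 1)%N.
  apply: eq_bigl => u; rewrite -val_eqE /=.
  case: leqP => [le_r | gt_r] /=; first by rewrite inordK.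
  by apply/esym/negbTE; rewrite neq_ltn (leq_trans (ltn_ord i)) ?orbT.
rewrite (partition_big (@row_supp K n) (fun A => #|A| == i)) //=.
under eq_bigr => A /eqP cardA.
  rewrite (eq_bigl (fun u => u \in [set u | row_supp u == A])); last first.
    move=> u; rewrite inE andb_idl // => /eqP ->; exact/eqP.
  rewrite sum1_card card_row_supp cardA; over.
by rewrite sum_nat_const mulnC -[X in 'C(X, i)]card_ord -card_draws cardsE.
Qed.

(** * Bases of low weight *)

(** Normalising [M] to the identity on [m] independent columns makes each row vanish on the [m - 1]
    chosen columns other than its own. *)
Lemma weight_row_basis (K : fieldType) (m n : nat) (M : 'M[K]_(m, n)) :
  row_free M ->
  exists2 E : 'M[K]_(m, n), row_free E /\ (M <= E)%MS &
    forall i, (#|row_supp (row i E)| <= n - m + 1)%N.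
Proof.
move=> freeM.
(* Transposing lets [fullrankfun], which selects independent rows, select columns of [M]. *)
have fullMt : row_full M^T by rewrite /row_full mxrank_tr.
pose f := fullrankfun fullMt.
pose C := colsub f M.
have unitC : C \in unitmx.
  by rewrite -unitmx_tr /C trmx_mxsub; exact: fullrowsub_unit.
have freeC : row_free (invmx C) by rewrite row_free_unit unitmx_inv.
exists (invmx C *m M).
  split; first by rewrite /row_free mxrankMfree //; exact: freeC.
  by rewrite -{1}(mulKVmx unitC M) submxMl.
move=> i; have Ef j : (invmx C *m M) i (f j) = (i == j)%:R.
  transitivity ((invmx C *m C) i j); last by rewrite mulVmx // mxE.
  by rewrite !mxE; apply: eq_bigr => k _; rewrite !mxE.
have sub : row_supp (row i (invmx C *m M)) \subset ~: (f @: [set~ i]).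
  apply/fintype.subsetP=> j; rewrite !inE mxE; apply: contra => /imsetP[k].
  by rewrite !inE eq_sym => /negbTE ki ->; rewrite Ef ki.
apply: leq_trans (subset_leq_card sub) _.
rewrite cardsCs finset.setCK card_imset; last exact: fullrankfun_inj.
have m_le : (m <= n)%N by rewrite -(eqP freeM) rank_leq_col.
by have := ltn_ord i; rewrite cardsC1 !card_ord; lia.
Qed.

(** In the factorisation of [u] through [row_ebase u], the first [\rank u] rows of this invertible
    matrix span the row space; taking its first [m] rows instead extends them to an independent
    family. *)
Lemma exists_row_free_overspace (K : fieldType) (m n : nat) (u : 'M[K]_(m, n)) :
  (m <= n)%N -> exists2 M : 'M[K]_(m, n), row_free M & (u <= M)%MS.
Proof.
move=> le_mn; exists (pid_mx m *m row_ebase u).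
  by rewrite /row_free mxrankMfree ?row_free_unit ?row_ebase_unit // rank_pid_mx.
rewrite -{1}(mulmx_ebase u).
have -> : (pid_mx (\rank u) : 'M[K]_(m, n)) =
          (pid_mx (\rank u) : 'M[K]_m) *m (pid_mx m : 'M[K]_(m, n)).
  rewrite mul_pid_mx; congr pid_mx.
  by have := rank_leq_row u; have := rank_leq_col u; lia.
by rewrite mulmxA -mulmxA submxMl.
Qed.

(** * Projective points and their generating vectors *)

Lemma dim_delta_line (F : fieldType) (v : nat) :
  \dim <[delta_mx ord0 ord0 : 'rV[F]_v.+1]>%VS == 1%N.
Proof.
rewrite dim_vline eqb1; apply/eqP=> /rowP/(_ ord0)/eqP.
by rewrite !mxE !eqxx oner_eq0.
Qed.

(* The point is arbitrary when w = 0. *)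
Definition pg_line (F : fieldType) (v : nat) (w : 'rV[F]_v.+1) : pg_point F v :=
  insubd (PGPoint (dim_delta_line F v)) <[w]>%VS.

Lemma pg_lineE (F : fieldType) (v : nat) (w : 'rV[F]_v.+1) :
  w != 0 -> pg_space (pg_line w) = <[w]>%VS.
Proof. by move=> w0; rewrite [LHS]val_insubd dim_vline w0. Qed.

Lemma pg_line_eq (F : fieldType) (v : nat) (w1 w2 : 'rV[F]_v.+1) :
  w1 != 0 -> w2 != 0 ->
  reflect (exists2 c, c != 0 & w2 = c *: w1) (pg_line w2 == pg_line w1).
Proof.
move=> w10 w20; rewrite -val_eqE /= !pg_lineE //; apply: (iffP eqP).
  move=> E; have /vlineP[c Dw2] : w2 \in <[w1]>%VS by rewrite -E memv_line.
  by exists c => //; apply: contraNneq w20 => c0; rewrite Dw2 c0 scale0r.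
move=> [c c0 ->]; apply/eqP; rewrite eqEsubv -!memvE.
rewrite memvZ ?memv_line //=; apply/vlineP; exists c^-1.
by rewrite scalerA mulVf ?scale1r.
Qed.

Lemma pg_point_line (F : fieldType) (v : nat) (x : pg_point F v) :
  exists2 w : 'rV[F]_v.+1, w != 0 & pg_space x = <[w]>%VS.
Proof.
have x1 := pg_pointP x; pose w := vpick (pg_space x).
have w0 : w != 0 by rewrite vpick0 -dimv_eq0 (eqP x1).
exists w => //; apply/eqP; rewrite eq_sym eqEdim -memvE memv_pick /=.
by rewrite (eqP x1) dim_vline w0.
Qed.

(** Comparing entries where [u] is nonzero shows that [a] comes from [K]. Hence distinct points over
    [K] stay distinct over [F]. *)
Lemma map_mx_proportional (F K : fieldType) (iota : {rmorphism K -> F}) (n : nat)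
    (u w : 'rV[K]_n) (a : F) :
  u != 0 -> map_mx iota w = a *: map_mx iota u -> exists c, w = c *: u.
Proof.
rewrite -row_supp_eq0 => /set0Pn[j]; rewrite inE => uj0 E.
exists (w 0 j / u 0 j).
have Da : a = iota (w 0 j / u 0 j).
  have := congr1 (fun w : 'rV_n => w 0 j) E; rewrite !mxE => Ej.
  by rewrite fmorph_div Ej mulfK // fmorph_eq0.
apply/rowP => i; apply: (fmorph_inj iota).
by have := congr1 (fun w : 'rV_n => w 0 i) E; rewrite !mxE Da -rmorphM.
Qed.

(** * The saturating set and its size *)

Definition low_weight (K : finFieldType) (n r : nat) : {set 'rV[K]_n} :=
  [set u | (0 < #|row_supp u| <= r)%N].

Definition subgeometry_points (F K : finFieldType) (iota : {rmorphism K -> F})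
    (v r : nat) : {set pg_point F v} :=
  [set pg_line (map_mx iota u) | u in low_weight K v.+1 r].

Lemma low_weight_neq0 (K : finFieldType) (n r : nat) (u : 'rV[K]_n) :
  u \in low_weight K n r -> u != 0.
Proof. by rewrite inE card_gt0 row_supp_eq0 => /andP[]. Qed.

Lemma card_low_weight (K : finFieldType) (n r : nat) :
  (#|low_weight K n r|.+1)%N = hamming_ball_size #|K| n r.
Proof.
rewrite -card_hamming_ball [RHS](cardsD1 0) inE.
have -> : #|row_supp (0 : 'rV[K]_n)| = 0%N.
  by apply/eqP; rewrite cards_eq0 row_supp_eq0.
rewrite add1n; congr _.+1; apply: eq_card => u.
by rewrite !inE card_gt0 row_supp_eq0.
Qed.

(** Each fibre of the map from low-weight vectors to points consists of the [#|K| - 1] nonzero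
    [K]-multiples of one vector; the successor accounts for the zero vector. *)
Lemma card_subgeometry_points (F K : finFieldType) (iota : {rmorphism K -> F})
    (v r : nat) :
  (#|subgeometry_points iota v r| * (#|K| - 1)).+1 =
  hamming_ball_size #|K| v.+1 r.
Proof.
rewrite -card_low_weight -[in RHS]sum1_card.
rewrite (partition_big_imset (fun u => pg_line (map_mx iota u))) /=.
rewrite -sum_nat_const; congr _.+1; apply: eq_bigr => _ /imsetP[u uW ->].
have u0 := low_weight_neq0 uW.
have inj : injective (fun c => c *: u).
  move=> c d /eqP; rewrite -subr_eq0 -scalerBl scaler_eq0 (negbTE u0) orbF.
  by rewrite subr_eq0 => /eqP.
rewrite subn1 -(cardC1 (0 : K)) -(card_imset _ inj) -sum1_card.
apply: eq_bigl => w; apply/imsetP/andP.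
  case=> c; rewrite !inE => c0 ->.
  split; first by move: uW; rewrite !inE row_suppZ.
  apply/pg_line_eq; rewrite ?map_mx_eq0 ?scaler_eq0 ?negb_or ?c0 //.
  by exists (iota c); rewrite ?fmorph_eq0 // map_mxZ.
case=> wW; have w0 := low_weight_neq0 wW.
case/pg_line_eq; rewrite ?map_mx_eq0 // => a _ /(map_mx_proportional u0)[c Dw].
exists c => //; rewrite !inE; apply: contraNneq w0 => c0.
by rewrite Dw c0 scale0r.
Qed.

(** * Covering by [k + 1] points, and minimality *)

Lemma subgeometry_covered (F K : finFieldType) (iota : {rmorphism K -> F})
    (v k : nat) (b : 'I_k.+1 -> F) :
  (k <= v)%N ->
  (forall x, exists c : 'I_k.+1 -> K, x = \sum_i iota (c i) * b i) ->
  pg_covered k (subgeometry_points iota v (v - k + 1)).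
Proof.
move=> le_kv span x; have [w w0 ->] := pg_point_line x.
have [c Dw] := fin_all_exists (fun j => span (w 0 j)).
(* Column [j] holds the [K]-coordinates of [w 0 j]. The rank of [u] may be below [k + 1], so its row
   space is enlarged to obtain exactly [k + 1] distinct points. *)
pose u : 'M[K]_(k.+1, v.+1) := \matrix_(i, j) c j i.
have [M freeM uM] := exists_row_free_overspace u le_kv.
have [E [freeE ME] wtE] := weight_row_basis freeM.
have /submxP[D uDE] := submx_trans uM ME.
have E0 i : row i E != 0.
  apply/eqP => Ei0; have /row_freeP[E' EE'] := freeE.
  have := congr1 (fun A : 'M[K]_k.+1 => A i i) EE'.
  rewrite mxE; under eq_bigr => j _.
    have -> : E i j = row i E 0 j by rewrite mxE.
    rewrite Ei0 mxE mul0r; over.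
  by rewrite big1 // !mxE eqxx => /esym/eqP; rewrite oner_eq0.
pose f i := pg_line (map_mx iota (row i E)).
have fE i : pg_space (f i) = <[map_mx iota (row i E)]>%VS.
  by rewrite pg_lineE ?map_mx_eq0.
have f_inj : injective f.
  (* Equal points would make two rows of [E] proportional over [K], which independence allows only
     for equal indices. *)
  move=> i i' /eqP/pg_line_eq; rewrite !map_mx_eq0 => /(_ (E0 _) (E0 _)).
  case=> a _ /(map_mx_proportional (E0 _))[d].
  rewrite !rowE scalemxAl => /(row_free_inj freeE)/rowP/(_ i).
  rewrite !mxE !eqxx /=; case: eqP => //= _ /eqP.
  by rewrite mulr0 oner_eq0.
exists (f @: 'I_k.+1); split.
- apply/fintype.subsetP=> _ /imsetP[i _ ->]; apply: imset_f; rewrite inE.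
  by rewrite card_gt0 row_supp_eq0 E0 -(subSS k v) wtE.
- by rewrite card_imset // card_ord.
rewrite big_imset /=; last by move=> i i' _ _; apply: f_inj.
have -> : w = \sum_i ((\row_i b i) *m map_mx iota D) 0 i *:
                    map_mx iota (row i E).
  have -> : w = (\row_i b i) *m map_mx iota u.
    apply/rowP=> j; rewrite Dw !mxE; apply: eq_bigr => i _.
    by rewrite !mxE mulrC.
  rewrite uDE map_mxM mulmxA mulmx_sum_row.
  by apply: eq_bigr => i _; rewrite map_row.
rewrite -memvE; apply: memv_sumr => i _.
by rewrite fE memvZ ?memv_line.
Qed.

Lemma mxrank_sum_leq_card (K : fieldType) (I : finType) (P : {pred I})
    (m n : nat) (A : I -> 'M[K]_(m, n)) :
  (forall i, P i -> (\rank (A i) <= 1)%N) ->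
  (\rank (\sum_(i in P) A i)%R <= #|P|)%N.
Proof.
move=> A1; rewrite -sum1_card.
elim/big_ind2: _ => [|? ? ? ? h1 h2|]; [by rewrite mxrank0 | | exact: A1].
by apply: leq_trans (mxrank_add _ _) _; apply: leq_add.
Qed.

(** Through [b], a vector over [F] is the same as an [m]-row matrix over [K]. Vectors on a
    [K]-rational point give rank at most 1, so a vector with a matrix of rank [m] lies in the span
    of no fewer than [m] such points. *)
Lemma subgeometry_covered_min (F K : finFieldType) (iota : {rmorphism K -> F})
    (v r m k : nat) (b : 'I_m -> F) :
  (m <= v.+1)%N ->
  (forall x, exists c : 'I_m -> K, x = \sum_i iota (c i) * b i) ->
  (forall c : 'I_m -> K, \sum_i iota (c i) * b i = 0 -> forall i, c i = 0) ->
  pg_covered k (subgeometry_points iota v r) -> (m <= k.+1)%N.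
Proof.
move=> le_mv span free cov.
pose B : 'rV[F]_m := \row_i b i.
have B_inj : injective (fun A : 'M[K]_(m, v.+1) => B *m map_mx iota A).
  move=> A1 A2 /eqP; rewrite -subr_eq0 -mulmxBr -map_mxB => /eqP E.
  apply/eqP; rewrite -subr_eq0; apply/eqP/matrixP=> i j; rewrite [RHS]mxE.
  apply: (free (fun i => (A1 - A2) i j)).
  have := congr1 (fun w : 'rV_v.+1 => w 0 j) E; rewrite [RHS]mxE => Ej.
  by apply: etrans Ej; rewrite [RHS]mxE; apply: eq_bigr => l _;
    rewrite !mxE mulrC.
have [m0 | m_gt0] := posnP m; first by rewrite {1}m0.
(* The bound [m <= v.+1] gives this matrix rank [m]; [w] is the vector that it encodes. *)
pose P : 'M[K]_(m, v.+1) := pid_mx m.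
have rankP : \rank P = m by rewrite rank_pid_mx.
pose w := B *m map_mx iota P.
have w0 : w != 0.
  apply/eqP => w0; have P0 : P = 0 by apply: B_inj; rewrite /= map_mx0 mulmx0.
  by move: rankP m_gt0; rewrite P0 mxrank0 => <-.
have [T [/fintype.subsetP TS cardT]] := cov (pg_line w).
rewrite pg_lineE // -memvE => /memv_sumP[vs vsT Dw].
have vsA y : exists A : 'M[K]_(m, v.+1), y \in T ->
    vs y = B *m map_mx iota A /\ (\rank A <= 1)%N.
  (* Outside [T] the zero matrix is a dummy value, so that [A] can be chosen as a total function. *)
  case: (boolP (y \in T)) => yT; last by exists 0.
  have /imsetP[u /low_weight_neq0 u0 Dy] := TS y yT.
  have := vsT y yT; rewrite Dy pg_lineE ?map_mx_eq0 // => /vlineP[a Da].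
  have [c Dc] := span a.
  (* The multiple [a] of a [K]-rational [u] is encoded by the outer product of the coordinates of
     [a] with [u]. *)
  exists ((\col_i c i) *m u) => _; split; last first.
    exact: leq_trans (mxrankM_maxr _ _) (rank_leq_row _).
  rewrite Da map_mxM mulmxA; apply/rowP=> j; rewrite !mxE big_ord1 !mxE Dc.
  by congr (_ * _); apply: eq_bigr => i _; rewrite !mxE mulrC.
have [A AT] := fin_all_exists vsA.
have DP : P = \sum_(y in T) A y.
  apply: B_inj; rewrite /= -/w Dw raddf_sum mulmx_sumr.
  by apply: eq_bigr => y /AT[].
rewrite -cardT -{1}rankP DP; apply: mxrank_sum_leq_card => y yT.
by case: (AT y yT).
Qed.

(** * Asymptotics of the size *)

(** For [m = v - rho] and [n = v + 1], this is the size divided by [b ^ m], as a polynomial in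
    [1 / b]: the factor [(b - 1) ^ i / b ^ m] becomes [(1 - 'X) ^+ i * 'X^(m - i)]. *)
Definition scaled_size_poly (R : realType) (n m : nat) : {poly R} :=
  \sum_(i < m.+1) 'C(n, i.+1)%:R *: ((1 - 'X) ^+ i * 'X^(m - i)).

Lemma hamming_ball_sizeS (b n r : nat) :
  hamming_ball_size b n r.+1 =
  ((\sum_(i < r.+1) (b - 1) ^ i * 'C(n, i.+1)) * (b - 1)).+1.
Proof.
rewrite /hamming_ball_size big_ord_recl bin0 mul1n add1n; congr _.+1.
by rewrite big_distrl; apply: eq_bigr => i _; rewrite lift0 expnSr mulnAC.
Qed.

Lemma saturating_size_horner (R : realType) (rho v b : nat) :
  (1 < b)%N -> saturating_size R rho v b =
  (scaled_size_poly R (v + 1) (v - rho)).[b%:R^-1] * b%:R ^+ (v - rho).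
Proof.
move=> b_gt1; have b_gt0 := ltnW b_gt1.
have b0 : b%:R != 0 :> R by rewrite pnatr_eq0 -lt0n.
rewrite /saturating_size addn1 addn1 hamming_ball_sizeS -natr1 addrK natrM.
rewrite -(natrB _ b_gt0) mulfK ?pnatr_eq0 -?lt0n ?subn_gt0 //.
rewrite horner_sum natr_sum mulr_suml; apply: eq_bigr => i _.
rewrite !hornerE natrM natrX natrB // mulrC -!mulrA; congr (_ * _).
have le_i : (i <= v - rho)%N by rewrite -ltnS.
rewrite -[X in b%:R ^+ X](subnK le_i) exprD mulrA.
rewrite exprVn -!mulrA [X in _ * X](_ : _ = b%:R ^+ i); last first.
  by rewrite mulKf // expf_neq0.
by rewrite -exprMn mulrBl mul1r mulVf.
Qed.

Lemma scaled_size_poly0 (R : realType) (n m : nat) :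
  (scaled_size_poly R n m).[0] = 'C(n, m.+1)%:R.
Proof.
rewrite horner_sum big_ord_recr /= big1 ?add0r => [|i _].
  by rewrite subnn expr0 mulr1 !hornerE subr0 expr1n mulr1.
by rewrite !hornerE expr0n subn_eq0 leqNgt ltn_ord /= !mulr0.
Qed.

(** The exponent [rho + 1] cancels, and the constant term ['C(v + 1, v - rho + 1)] equals
    ['C(v + 1, rho)] by symmetry. *)
Lemma asymptotic_term (R : realType) (rho v q' : nat) :
  (rho <= v)%N ->
  'C(v + 1, rho)%:R * (q' ^ (rho + 1))%:R `^ ((v%:R - rho%:R) / (rho%:R + 1)) =
  (scaled_size_poly R (v + 1) (v - rho)).[0] * q'%:R ^+ (v - rho) :> R.
Proof.
move=> le_rho; rewrite scaled_size_poly0.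
rewrite (_ : (v - rho).+1 = v + 1 - rho)%N ?bin_sub; try lia.
congr (_ * _).
rewrite natrX -powR_mulrn // -powRrM -natrB // natrD mulrC divfK.
  by rewrite powR_mulrn.
by rewrite natr1 pnatr_eq0.
Qed.

Local Open Scope classical_set_scope.

Lemma saturating_size_equiv (R : realType) (rho v : nat) :
  (rho <= v)%N ->
  (fun q' : nat => saturating_size R rho v q' : R^o) ~_(within prime_power \oo)
  (fun q' : nat => 'C(v + 1, rho)%:R *
     (q' ^ (rho + 1))%:R `^ ((v%:R - rho%:R) / (rho%:R + 1)) : R^o).
Proof.
move=> le_rho; apply/eqaddoP => eps eps_gt0.
set p := scaled_size_poly R (v + 1) (v - rho).
have p0 : 0 < p.[0] by rewrite scaled_size_poly0 ltr0n bin_gt0; lia.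
have inv0 : (n%:R^-1 : R) @[n --> \oo] --> (0 : R).
  apply/gtr0_cvgV0; last exact: cvgr_idn.
  by near=> n; rewrite ltr0n; near: n; exact: nbhs_infty_gt.
have cvgp : p.[n%:R^-1] @[n --> \oo] --> p.[0].
  by apply: (cvg_comp _ _ inv0); exact: continuous_horner.
have near_p : \forall n \near \oo, `|p.[0] - p.[n%:R^-1]| < eps * p.[0].
  by move/cvgrPdist_lt: cvgp; apply; rewrite mulr_gt0.
(* The estimate holds for all large integers, so in particular along prime powers. After the common
   power of [n] is factored out, it is the continuity of [p] at 0. *)
apply: cvg_within; near=> n.
rewrite !fctE asymptotic_term // saturating_size_horner; last first.
  by near: n; exact: nbhs_infty_gt.
rewrite -mulrBl !normrM mulrA ler_wpM2r // distrC (gtr0_norm p0) ltW //.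
by near: n.
Unshelve. all: by end_near.
Qed.

Theorem theorem7 (R : realType) (rho v : nat) (rho_gt0 : (0 < rho)%N)
    (v_gt : (rho + 1 < v)%N) :
  (forall (q' q : nat) (F : finFieldType),
     prime_power q' -> q = (q' ^ (rho + 1))%N -> #|F| = q ->
     exists S : {set pg_point F v},
       saturating rho S /\ #|S|%:R = saturating_size R rho v q') /\
  (fun q' : nat => saturating_size R rho v q' : R^o)
    ~_(within prime_power \oo)
  (fun q' : nat => 'C(v + 1, rho)%:R *
     (q' ^ (rho + 1))%:R `^ ((v%:R - rho%:R) / (rho%:R + 1)) : R^o).
Proof.
have le_rho : (rho <= v)%N by lia.
split; last exact: saturating_size_equiv.
move=> q' q F q'_pp -> cardF.
have [K [iota [b [cardK span free]]]] :=
  finField_basis_over_subfield q'_pp cardF.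
exists (subgeometry_points iota v (v - rho + 1)).
rewrite addn1 in b span free; split.
  split; first exact: subgeometry_covered span.
  move=> k /(subgeometry_covered_min _ span free); lia.
(* This makes the denominator [q' - 1] invertible. *)
have q'_gt1 : (1 < q')%N by rewrite -cardK finNzRing_gt1.
rewrite /saturating_size !addn1 -cardK.
rewrite -(card_subgeometry_points iota) -natr1 addrK.
by rewrite natrM natrB ?mulfK ?subr_eq0 ?pnatr_eq1 ?cardK //; lia.
Qed.
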